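(* For every prime power $q$, there exist eight pairwise disjoint planes of $\mathrm{PG}(5,q)$ in higgledy-piggledy arrangement.
   Context: $\mathrm{PG}(N,q)$ denotes the Desarguesian projective space of dimension $N$ over $\mathbb{F}_q$. For $k\in\{0,1,\dots,N-1\}$, a strong $k$-blocking set of $\mathrm{PG}(N,q)$ is a point set that meets every $(N-k)$-dimensional subspace $\kappa$ in a set of points spanning $\kappa$. A set $\mathcal{K}$ of $k$-subspaces of $\mathrm{PG}(N,q)$ is a higgledy-piggledy set (its elements are in higgledy-piggledy arrangement) if the set of all points lying in at least one element of $\mathcal{K}$ is a strong $k$-blocking set. *)

(* Defs.v *)
From HB Require Import structures.
From mathcomp Require Import all_boot all_order all_algebra.

Set Implicit Arguments.
Unset Strict Implicit.
Unset Printing Implicit Defensive.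

Import GRing.Theory.

(* Vector subspaces are stored as canonical matrices, so over a finite field
   they form a finite type. *)
Section FiniteVspace.
Import VectorInternalTheory.
Variables (F : finFieldType) (n : nat).
HB.instance Definition _ := [Countable of {vspace 'rV[F]_n} by <:].
HB.instance Definition _ := [Finite of {vspace 'rV[F]_n} by <:].
End FiniteVspace.

(* PG(N, q) is the lattice of subspaces of 'rV[F]_N.+1 with #|F| = q; a
   subspace of projective dimension d has vector-space dimension d.+1. *)
Definition psubspaces (F : finFieldType) (N d : nat) :
    {set {vspace 'rV[F]_N.+1}} :=
  [set U | \dim U == d.+1].

Definition ppoints (F : finFieldType) (N : nat) (U : {vspace 'rV[F]_N.+1}) :
    {set {vspace 'rV[F]_N.+1}} :=
  [set P in psubspaces F N 0 | (P <= U)%VS].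

Definition pspan (F : finFieldType) (N : nat)
    (S : {set {vspace 'rV[F]_N.+1}}) : {vspace 'rV[F]_N.+1} :=
  (\sum_(P in S) P)%VS.

(* Intended for k < N; N - k is truncated subtraction. *)
Definition strong_blocking (F : finFieldType) (N k : nat)
    (S : {set {vspace 'rV[F]_N.+1}}) : Prop :=
  S \subset psubspaces F N 0 /\
  forall kappa : {vspace 'rV[F]_N.+1}, kappa \in psubspaces F N (N - k) ->
    pspan (S :&: ppoints kappa) = kappa.

Definition higgledy_piggledy (F : finFieldType) (N k : nat)
    (K : {set {vspace 'rV[F]_N.+1}}) : Prop :=
  K \subset psubspaces F N k /\
  strong_blocking k (\bigcup_(U in K) ppoints U).

Definition pairwise_disjoint (F : finFieldType) (N : nat)
    (K : {set {vspace 'rV[F]_N.+1}}) : Prop :=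
  {in K &, forall U W : {vspace 'rV[F]_N.+1},
     U != W -> [disjoint ppoints U & ppoints W]}.

(* Main.v *)
Require Import Defs.
From HB Require Import structures.
From mathcomp Require Import all_boot all_order all_fingroup all_algebra.
From mathcomp Require Import all_field qfpoly zify.

Set Implicit Arguments.
Unset Strict Implicit.
Unset Printing Implicit Defensive.

Import GRing.Theory.
Local Open Scope ring_scope.

(** Let n = 3 and let K be the extension of F of degree n.  In V = K x K the
    spaces S_t = {(x, t x)}, for t in K, are pairwise disjoint of F-dimension n.
    An n-dimensional F-subspace U with basis (a_i, b_i) meets S_t only in 0 iff
    the elements b_i - t a_i are F-free, i.e. iff the Moore determinant
    det ((b_i - t a_i)^(q^j)) is nonzero.  Its j-th column is affine in t^(q^j),
    so as a function of t it is a K-combination of the 2^n functions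
    prod_(j in I) t^(q^j).  Hence there is a set J of 2^n values of t such that
    a determinant of this kind that vanishes on J vanishes on all of K.  But U
    cannot meet all q^n pairwise disjoint spaces S_t, as it has only q^n - 1
    nonzero vectors.  So every subspace of dimension at most n meets some
    S_t with t in J only in 0, while every kappa of dimension n + 1 meets all of
    them: the intersection points with kappa span more than n dimensions. *)

(** * Finite test sets, column expansion of determinants, and enlarging subspaces *)

Lemma superset_of_card (T : finType) (A : {set T}) (m : nat) :
  (#|A| <= m <= #|T|)%N -> exists2 B : {set T}, A \subset B & #|B| = m.
Proof.
move=> /andP[leAm]; rewrite -(subnKC leAm); move: (m - _)%N => d {m leAm}.
elim: d A => [|d IHd] A leT; first by exists A; rewrite ?addn0.
have /subsetPn[x _ xA] : ~~ ([set: T] \subset A).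
  by apply/negP => /subset_leq_card; rewrite cardsT; lia.
have cxA : #|x |: A| = #|A|.+1 by rewrite cardsU1 xA.
have [|B sB cB] := IHd (x |: A); first by rewrite cxA addSnnS.
exists B; first exact: subset_trans (subsetUr _ _) sB.
by rewrite cB cxA addSnnS.
Qed.

(* J indexes a maximal free family of rows of the matrix (w t i). *)
Lemma finite_test_set (K : fieldType) (T I : finType) (w : T -> I -> K) :
  exists2 J : {set T}, (#|J| <= #|I|)%N &
    forall c : I -> K,
      {in J, forall t, \sum_i w t i * c i = 0} ->
      forall t, \sum_i w t i * c i = 0.
Proof.
pose A := \matrix_(i < #|T|, j < #|I|) w (enum_val i) (enum_val j).
pose f := maxrankfun A.
exists [set enum_val (f k) | k : 'I_(\rank A)].
  by rewrite (leq_trans (leq_imset_card _ _)) // card_ord rank_leq_col.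
move=> c cJ t; pose u := \col_(j < #|I|) c (enum_val j).
have AuE i : (A *m u) i 0 = \sum_j w (enum_val i) j * c j.
  rewrite mxE (reindex_onto (@enum_rank I) (@enum_val I _)) /=; last first.
    by move=> j _; rewrite enum_valK.
  by apply: eq_big => j; rewrite ?mxE ?enum_rankK ?eqxx.
have /submxP[D defA] : (A <= rowsub f A)%MS by rewrite eq_maxrowsub.
suffices Au0 : A *m u = 0.
  by have := AuE (enum_rank t); rewrite enum_rankK => <-; rewrite Au0 mxE.
rewrite defA -mulmxA; suffices -> : rowsub f A *m u = 0 by rewrite mulmx0.
apply/colP => k; rewrite mul_rowsub_mx mxE AuE mxE.
by apply: cJ; apply: imset_f.
Qed.

(** In the Leibniz formula each column contributes either its [A] or its [B] entry; [J] records the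
    columns taken from [A]. What matters later is that [c] does not depend on [d]. *)
Lemma det_addcols (R : comNzRingType) (n : nat) (A B : 'M[R]_n) :
  exists c : {set 'I_n} -> R, forall d : 'I_n -> R,
    \det (\matrix_(i, j) (d j * A i j + B i j)) =
    \sum_(J : {set 'I_n}) (\prod_(j in J) d j) * c J.
Proof.
exists (fun J : {set 'I_n} => \sum_(s : 'S_n) (-1) ^+ s *
  ((\prod_(j in J) A (s j) j) * (\prod_(j in ~: J) B (s j) j))).
move=> d; rewrite -det_tr /determinant; under [RHS]eq_bigr do rewrite mulr_sumr.
rewrite exchange_big /=; apply: eq_bigr => s _.
under eq_bigr do rewrite !mxE.
rewrite bigA_distr mulr_sumr; apply: eq_bigr => J _.
rewrite mulrCA; congr (_ * _); rewrite mulrA -big_split /=.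
rewrite (bigID (mem J)) /=; congr (_ * _).
  by apply: eq_bigr => j ->.
by apply: eq_big => j; rewrite ?inE // => /negbTE->.
Qed.

Lemma vspace_superset (F : fieldType) (V : vectType F) (U : {vspace V}) m :
  (\dim U <= m <= \dim {:V})%N ->
  exists2 W : {vspace V}, (U <= W)%VS & \dim W = m.
Proof.
move=> /andP[leUm]; rewrite -(subnKC leUm); move: (m - _)%N => d {m leUm}.
elim: d U => [|d IHd] U leV; first by exists U; rewrite ?addn0.
have /subvPn[x _ xU] : ~~ ({:V} <= U)%VS by apply/negP => /dimvS; lia.
have dimUx : \dim (U + <[x]>) = (\dim U).+1.
  have x0 : x != 0 by apply: contraNneq xU => ->; rewrite mem0v.
  rewrite dimv_disjoint_sum ?dim_vline ?x0 ?addn1 //.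
  apply/eqP; rewrite -subv0; apply/subvP => y; rewrite memv_cap.
  case/andP => yU /vlineP[k def_y]; move: yU; rewrite def_y memv0 rpredZeq.
  by rewrite (negbTE xU) orbF => /eqP->; rewrite scale0r.
have [|W sUW dimW] := IHd (U + <[x]>)%VS; first by rewrite dimUx addSnnS.
exists W; first exact: subv_trans (addvSl _ _) sUW.
by rewrite dimW dimUx addSnnS.
Qed.

Lemma card_finvect (F : finFieldType) (K : fieldExtType F) :
  #|finvect_type K| = (#|F| ^ \dim {:K})%N.
Proof.
pose cK := Vector.class (finvect_type K : vectType F).
by rewrite -(@card_vspacef F (finvect_type K) cK) card_vspace !dimvf.
Qed.

(** * The Moore determinant as a test for freeness over [F] *)

Section Moore.
Variables (F : finFieldType) (K : fieldExtType F) (n : nat).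
Implicit Type x : n.-tuple K.

Lemma frobeniusD (y z : K) j :
  (y + z) ^+ (#|F| ^ j) = y ^+ (#|F| ^ j) + z ^+ (#|F| ^ j).
Proof.
have [p p_pr charFp] := finPcharP F.
have charKp : p \in [pchar K] by rewrite pchar_lalg.
apply: exprDn_pchar; rewrite (eq_pnat _ (pcharf_eq charKp)) pnatX.
by rewrite (card_pprimeChar charFp) pnatX pnat_id.
Qed.

Lemma frobenius_comb (I : Type) (r : seq I) (k : I -> F) (y : I -> K) j :
  (\sum_(i <- r) k i *: y i) ^+ (#|F| ^ j) =
  \sum_(i <- r) k i *: y i ^+ (#|F| ^ j).
Proof.
have kq (c : F) : c ^+ (#|F| ^ j) = c.
  by elim: j => [|j IHj]; rewrite ?expr1 // expnS exprM expf_card.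
elim/big_rec2: _ => [|i u v _ IH]; last by rewrite frobeniusD IH exprZn kq.
by rewrite expr0n expn_eq0 -leqn0 leqNgt ltnW ?finNzRing_gt1.
Qed.

Definition moore_mx x : 'M[K]_n := \matrix_(i, j) x`_i ^+ (#|F| ^ j).

(** An [F]-relation among the entries of [x] survives every Frobenius power, hence is a relation
    among the rows. Conversely, a relation among the columns is an [F]-linear polynomial vanishing
    on the span of [x], too large a root set when [x] is free. *)
Lemma det_moore_neq0 x : (\det (moore_mx x) != 0) = free x.
Proof.
apply/idP/idP => [detN0 | freex].
  apply/freeP => k xk0 i; apply/eqP/negPn/negP => ki0.
  case/det0P: detN0; exists (\row_j (k j)%:A).
    apply: contraNneq ki0 => /rowP/(_ i)/eqP; rewrite !mxE scaler_eq0.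
    by rewrite oner_eq0 orbF.
  apply/rowP => j; rewrite !mxE.
  under eq_bigr do rewrite !mxE -scalerAl mul1r.
  rewrite -frobenius_comb xk0 expr0n expn_eq0.
  by rewrite -leqn0 leqNgt ltnW ?finNzRing_gt1.
rewrite -det_tr; apply/det0P => -[v v0 vM0].
have q1 : (1 < #|F|)%N := finNzRing_gt1 F.
(* p has degree at most q^(n-1) and vanishes on the q^n combinations of x. *)
pose p := \sum_(j < n) v 0 j *: 'X^(#|F| ^ j).
have p0 : p != 0.
  have [j vj0] : exists j, v 0 j != 0 by apply/rV0Pn.
  apply: contraNneq vj0 => /polyP/(_ (#|F| ^ j)%N).
  rewrite coef0 coef_sum (bigD1 j) //= coefZ coefXn eqxx mulr1.
  rewrite big1 ?addr0 => [-> //|i ij].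
  by rewrite coefZ coefXn eqn_exp2l // val_eqE eq_sym (negbTE ij) mulr0.
have size_p : (size p <= #|F| ^ n)%N.
  apply: leq_trans (size_sum _ _ _) _; apply/bigmax_leqP => j _.
  by rewrite (leq_trans (size_scale_leq _ _)) // size_polyXn ltn_exp2l.
pose comb (k : {ffun 'I_n -> F}) := \sum_i k i *: x`_i.
have comb_inj : injective comb.
  move=> k1 k2 /eqP; rewrite -subr_eq0 -sumrB => /eqP k12.
  apply/ffunP => i; apply/eqP; rewrite -subr_eq0; apply/eqP.
  move/freeP: freex => /(_ (fun i => k1 i - k2 i)); apply.
  by rewrite -[RHS]k12; apply: eq_bigr => j _; rewrite scalerBl.
have p_root : all (root p) (codom comb).
  apply/allP => _ /codomP[k ->]; rewrite /root horner_sum; apply/eqP.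
  under eq_bigr => j _.
    rewrite hornerZ hornerXn frobenius_comb mulr_sumr.
    under eq_bigr do rewrite -scalerAr.
    over.
  rewrite exchange_big big1 // => i _; rewrite -scaler_sumr.
  suffices -> : \sum_j v 0 j * x`_i ^+ (#|F| ^ j) = 0 by rewrite scaler0.
  move/rowP/(_ i): vM0; rewrite !mxE => vM0i; rewrite -[RHS]vM0i.
  by apply: eq_bigr => j _; rewrite !mxE.
have := max_poly_roots p0 p_root.
rewrite map_inj_uniq ?enum_uniq // => /(_ isT).
by rewrite size_map -cardE card_ffun card_ord ltnNge size_p.
Qed.

End Moore.

(** * The spaces S_t and the choice of the test slopes *)

(* V is identified with K x K through the coordinates a and b. *)
Section SlopeSpaces.
Variables (F : finFieldType) (K : fieldExtType F) (V : vectType F).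
Variables (a b : 'Hom(V, K)).
Hypothesis ab_inj : forall x, a x = 0 -> b x = 0 -> x = 0.
Local Notation n := (\dim {:K}).
Hypothesis dimV : \dim {:V} = n.*2.

Definition slope_space (t : K) : {vspace V} := lker (b - (amull t \o a)%VF).

Lemma slope_mapE t x : (b - (amull t \o a)%VF) x = b x - t * a x.
Proof. by rewrite add_lfunE opp_lfunE comp_lfunE lfunE. Qed.

Lemma mem_slope_space t x : (x \in slope_space t) = (b x == t * a x).
Proof. by rewrite memv_ker slope_mapE subr_eq0. Qed.

Lemma slope_space_inj t u x :
  x \in slope_space t -> x \in slope_space u -> x != 0 -> t = u.
Proof.
rewrite !mem_slope_space => /eqP bx /eqP; rewrite bx => /eqP.
rewrite -subr_eq0 -mulrBl mulf_eq0 subr_eq0 => /orP[/eqP//|/eqP ax0] /eqP[].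
by apply: ab_inj; rewrite // bx ax0 mulr0.
Qed.

Lemma cap_slope_space t u :
  t != u -> (slope_space t :&: slope_space u = 0)%VS.
Proof.
move=> tu; apply/eqP; rewrite -vpick0; apply: contraNT tu => x0; apply/eqP.
have := memv_pick (slope_space t :&: slope_space u).
by rewrite memv_cap => /andP[xt xu]; apply: slope_space_inj xt xu x0.
Qed.

(** The map [a] is injective on S_t, which bounds the dimension above by that of [K]; rank-nullity
    for [b - t a] bounds it below. *)
Lemma dim_slope_space t : \dim (slope_space t) = n.
Proof.
apply/anti_leq/andP; split.
  have [aS0|] := eqVneq (slope_space t :&: lker a)%VS 0%VS.
    by rewrite -(limg_dim_eq aS0) dimvS ?subvf.
  rewrite -vpick0 => /eqP[]; have := memv_pick (slope_space t :&: lker a).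
  rewrite memv_cap memv_ker mem_slope_space => /andP[/eqP bx /eqP ax].
  by apply: ab_inj; rewrite // bx ax mulr0.
pose f := b - (amull t \o a)%VF.
have dim_f : (\dim (slope_space t) + \dim (f @: fullv) = n.*2)%N.
  by rewrite -dimV -(limg_ker_dim f fullv) capfv.
rewrite -(leq_add2r (\dim (f @: fullv))) dim_f -addnn leq_add2l.
by rewrite dimvS ?subvf.
Qed.

(** S_t is the kernel of [f], so the intersection is trivial iff [f] is injective on [U], iff it
    sends the basis [h] to a free family. *)
Lemma cap_slope_space_eq0 (U : {vspace V}) (h : n.-tuple V) t :
  basis_of U h ->
  (U :&: slope_space t == 0)%VS =
  (\det (moore_mx (map_tuple (fun x => b x - t * a x) h)) != 0).
Proof.
move=> hU; pose f := b - (amull t \o a)%VF.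
have -> : map_tuple (fun x => b x - t * a x) h = map_tuple f h.
  by apply: val_inj; apply: eq_map => x; rewrite slope_mapE.
rewrite det_moore_neq0 /free -limg_span (span_basis hU) size_map size_tuple.
rewrite -dimv_eq0 -(eqn_add2r (\dim (f @: U))) limg_ker_dim add0n.
by rewrite -(size_basis hU) eq_sym.
Qed.

Lemma slope_space_avoiding (U : {vspace V}) :
  \dim U = n -> exists t, (U :&: slope_space t = 0)%VS.
Proof.
move=> dimU; pose x (t : finvect_type K) := vpick (U :&: slope_space t).
have [/existsP[t]|] := boolP [exists t, x t == 0].
  by rewrite vpick0 => /eqP; exists t.
rewrite negb_exists => /forallP xN0.
have xP t : (x t \in U) && (x t \in slope_space t).
  by rewrite -memv_cap memv_pick.
have x_inj : injective x.
  move=> t u xtu; have /andP[_ xt] := xP t; have /andP[_ xu] := xP u.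
  by apply: slope_space_inj xt _ (xN0 t); rewrite xtu.
have [h hU] : exists h : n.-tuple V, basis_of U h.
  by rewrite -dimU; exists (vbasis U); apply: vbasisP.
have xE t : x t = \sum_i coord h i (x t) *: h`_i.
  by apply: coord_basis hU _; case/andP: (xP t).
pose y t := \row_i coord h i (x t).
have y_inj : injective y.
  move=> t u /rowP ytu; apply: x_inj; rewrite xE [RHS]xE.
  by apply: eq_bigr => i _; have := ytu i; rewrite !mxE => ->.
(* [K] and the rows of length n both have q^n elements, so the injection [y] reaches the zero row,
   although no [x t] is zero. *)
have /codomP[t /rowP y0] : 0 \in codom y.
  by apply: inj_card_onto y_inj _ _; rewrite card_mx mul1n card_finvect.
case/eqP: (xN0 t); rewrite xE big1 // => i _.
by have := y0 i; rewrite !mxE => <-; rewrite scale0r.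
Qed.

Lemma avoiding_slopes : (2 ^ n <= #|finvect_type K|)%N ->
  exists2 J : {set finvect_type K}, #|J| = (2 ^ n)%N &
    forall U : {vspace V}, (\dim U <= n)%N ->
      exists2 t, t \in J & (U :&: slope_space t = 0)%VS.
Proof.
move=> le2K.
pose w (t : finvect_type K) (I : {set 'I_n}) : K :=
  \prod_(j in I) t ^+ (#|F| ^ j).
have [J0 leJ0 J0P] := finite_test_set w.
(* The test set [J0] may be smaller than 2^n; it is padded to the exact size. *)
have [|J sJ0 cJ] := @superset_of_card _ J0 (2 ^ n).
  by rewrite le2K andbT (leq_trans leJ0) // -cardsT -powersetT card_powerset
    cardsT card_ord.
exists J => // U leU.
(* Enlarging [U] to dimension exactly n makes the Moore matrix square. *)
have [|W sUW dimW] := @vspace_superset _ _ U n.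
  by rewrite leU dimV -addnn leq_addr.
suffices [t tJ Wt] : exists2 t, t \in J & (W :&: slope_space t == 0)%VS.
  by exists t => //; apply/eqP; rewrite -subv0 -(eqP Wt) capvS.
apply/exists_inP; apply: contraT; rewrite negb_exists_in => /forall_inP WJ.
have [h hW] : exists h : n.-tuple V, basis_of W h.
  by rewrite -dimW; exists (vbasis W); apply: vbasisP.
(* By additivity of Frobenius, column j is t^(q^j) times that of [A], plus the Moore column of
   [b]. *)
pose A : 'M[K]_n := moore_mx (map_tuple (fun x => - a x) h).
have [c cP] := det_addcols A (moore_mx (map_tuple b h)).
have detE t : \det (moore_mx (map_tuple (fun x => b x - t * a x) h)) =
    \sum_I w t I * c I.
  rewrite -cP; congr (\det _); apply/matrixP => i j; rewrite !mxE /=.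
  rewrite !(nth_map 0) ?size_tuple // -exprMn -frobeniusD.
  by rewrite mulrN addrC.
(* The determinant is nonzero at this [t], whereas vanishing on [J0] would force it to vanish
   everywhere. *)
have [t Wt] := slope_space_avoiding dimW.
move/eqP: Wt; rewrite (cap_slope_space_eq0 _ hW) detE J0P ?eqxx // => u uJ0.
have := WJ u (subsetP sJ0 u uJ0).
by rewrite (cap_slope_space_eq0 _ hW) detE negbK => /eqP.
Qed.

End SlopeSpaces.

(** * Existence of the coordinates and of the cubic extension *)

(** The coordinates in a basis of [V] are cut into two halves, each read as an element of [K]
    through a basis of [K]. *)
Lemma exists_coordinate_pair (F : fieldType) (V K : vectType F) :
  \dim {:V} = (\dim {:K}).*2 ->
  exists a b : 'Hom(V, K), forall x, a x = 0 -> b x = 0 -> x = 0.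
Proof.
rewrite -addnn; set n := \dim {:K} => dimV; pose Y := vbasis {:K}.
have [X XV] : exists X : (n + n).-tuple V, basis_of {:V} X.
  by rewrite -dimV; exists (vbasis fullv); apply: vbasisP.
pose f (g : 'I_n -> 'I_(n + n)) x := \sum_i coord X (g i) x *: Y`_i.
have f_lin g : linear (f g).
  move=> k x y; rewrite scaler_sumr -big_split; apply: eq_bigr => i _ /=.
  by rewrite linearP scalerDl scalerA.
have f_coord g x : f g x = 0 -> forall i, coord X (g i) x = 0.
  by apply/freeP/(basis_free (vbasisP _)).
pose fL g := linfun (HB.pack_for {linear V -> K} (f g)
  (GRing.isSemilinear.Build F V K _ (f g) (GRing.semilinear_linear (f_lin g)))).
exists (fL (lshift n)), (fL (@rshift n n)) => x.
rewrite !lfunE => /f_coord ax0 /f_coord bx0.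
rewrite (coord_basis XV (memvf x)) big_split_ord /=.
by rewrite !big1 ?addr0 // => i _; rewrite ?ax0 ?bx0 scale0r.
Qed.

Lemma exists_cubic_extension (F : finFieldType) :
  exists K : fieldExtType F, \dim {:K} = 3.
Proof.
(* x^3 - x vanishes at 0 and 1, so on the finite field F it misses some c. *)
pose g (x : F) := x ^+ 3 - x.
have [c gc] : exists c, c \notin codom g.
  apply/existsP; apply: contraT; rewrite negb_exists => /forallP g_onto.
  have iinvK : cancel (fun y => iinv (negbNE (g_onto y))) g.
    by move=> y; rewrite f_iinv.
  have g01 : g 0 = g 1 by rewrite /g expr0n expr1n !subrr.
  by have /eqP := can_inj (canF_sym iinvK) g01; rewrite eq_sym oner_eq0.
(* A root of this cubic would be a preimage of [c] under [g]; a cubic without roots is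
   irreducible. *)
pose p : {poly F} := 'X^3 + (- 'X - c%:P).
have size_p : size p = 4.
  rewrite size_polyDl size_polyXn // -opprD size_polyN.
  by rewrite size_XaddC.
have p_monic : p \is monic.
  rewrite monicE lead_coefDl ?lead_coefXn // size_polyXn -opprD size_polyN.
  by rewrite size_XaddC.
have p_irr : irreducible_poly p.
  apply: cubic_irreducible => [|x]; rewrite ?size_p // /root !hornerE.
  by apply: contra gc; rewrite subr_eq0 => /eqP <-; apply: (codom_f g).
exists {poly %/ p with (p_irr, p_monic)}.
by rewrite dim_polyn mk_monicE //= size_p.
Qed.

(** * Translation to projective spaces *)

Lemma vline_psubspaces (F : finFieldType) (N : nat) (v : 'rV[F]_N.+1) :
  v != 0 -> <[v]>%VS \in psubspaces F N 0.
Proof. by move=> v0; rewrite inE dim_vline v0. Qed.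

Lemma ppointsP (F : finFieldType) (N : nat) (U P : {vspace 'rV[F]_N.+1}) :
  reflect (exists v, [/\ v != 0, v \in U & P = <[v]>%VS]) (P \in ppoints U).
Proof.
apply: (iffP idP) => [|[v [v0 vU ->]]]; last first.
  by rewrite inE vline_psubspaces //= -memvE.
rewrite !inE => /andP[/eqP dimP sPU]; exists (vpick P).
have v0 : vpick P != 0 by rewrite vpick0 -dimv_eq0 dimP.
split=> //; first by rewrite (subvP sPU) ?memv_pick.
by apply/eqP; rewrite eq_sym eqEdim -memvE memv_pick dimP dim_vline v0.
Qed.

Lemma exists_higgledy_piggledy (F : finFieldType) (K : fieldExtType F) k :
  \dim {:K} = k.+1 ->
  exists Q : {set {vspace 'rV[F]_k.*2.+2}},
    [/\ #|Q| = (2 ^ k.+1)%N,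
        pairwise_disjoint (N := k.*2.+1) Q
      & higgledy_piggledy (N := k.*2.+1) k Q].
Proof.
move=> dimK; have dimV : \dim {:'rV[F]_k.*2.+2} = (\dim {:K}).*2.
  by rewrite dimK dimvf dim_matrix mul1r.
have [a [b ab_inj]] := exists_coordinate_pair dimV.
have [|J cardJ J_avoid] := avoiding_slopes ab_inj dimV.
  (* There is room for 2^n slopes because q is at least 2. *)
  by rewrite card_finvect leq_exp2r ?finNzRing_gt1 // dimK.
pose S (t : finvect_type K) := slope_space a b t.
have dimS t : \dim (S t) = k.+1 by rewrite -dimK (dim_slope_space ab_inj dimV).
have capS t u : t != u -> (S t :&: S u = 0)%VS by apply: cap_slope_space.
exists (S @: J); split.
- rewrite card_imset ?cardJ ?dimK // => t u Stu; apply/eqP; apply: contraT.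
  by move/capS/eqP; rewrite Stu capvv -dimv_eq0 dimS.
- move=> _ _ /imsetP[t _ ->] /imsetP[u _ ->] Stu.
  have tu : t != u by apply: contraNneq Stu => ->.
  apply/pred0P => P /=; apply/negP => /andP[/ppointsP[v [v0 vt ->]]].
  rewrite inE -memvE => /andP[_ vu]; case/negP: v0.
  by rewrite -memv0 -(capS _ _ tu) memv_cap vt.
split; first by apply/subsetP => _ /imsetP[t _ ->]; rewrite inE dimS.
split=> [|kappa].
  by apply/bigcupsP => U _; apply/subsetP => P; rewrite inE => /andP[].
rewrite inE (_ : (k.*2.+1 - k = k.+1)%N) => [/eqP dim_kappa|]; last first.
  by rewrite -addnn -addSn addnK.
set pts := _ :&: _.
have span_sub : (pspan pts <= kappa)%VS.
  by apply/subv_sumP => P; rewrite !inE => /andP[_ /andP[]].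
(* If the span were smaller than [kappa], its dimension would be at most k + 1, so some S_t with [t]
   in [J] would avoid it. *)
apply/eqP; rewrite eqEdim span_sub dim_kappa leqNgt ltnS /=.
rewrite -dimK; apply/negP => /J_avoid[t tJ span_t].
(* Grassmann: the dimensions k + 2 and k + 1 add up to more than 2k + 2. *)
have : (kappa :&: S t != 0)%VS.
  rewrite -dimv_eq0; have := dimv_sum_cap kappa (S t).
  have := dimvS (subvf (kappa + S t)); rewrite dim_kappa dimS dimV dimK.
  by lia.
rewrite -vpick0; set v := vpick _ => v0.
have /andP[v_kappa vt] : (v \in kappa) && (v \in S t).
  by rewrite -memv_cap memv_pick.
(* The point [<[v]>] is one of [pts], so [v] lies in the span and in S_t, a contradiction. *)
case/negP: (v0); rewrite -memv0 -span_t memv_cap vt andbT memvE.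
apply: (sumv_sup <[v]>%VS) => //; rewrite inE; apply/andP; split.
  apply/bigcupP; exists (S t); first exact: imset_f.
  by apply/ppointsP; exists v.
by apply/ppointsP; exists v.
Qed.

Local Close Scope ring_scope.

Theorem mainTheorem3 (q : nat)
    (hq : exists p e : nat, [/\ prime p, (0 < e)%N & q = (p ^ e)%N])
    (F : finFieldType) (hF : #|F| = q) :
  exists K : {set {vspace 'rV[F]_6}},
    [/\ #|K| = 8,
        pairwise_disjoint (N := 5) K
      & higgledy_piggledy (N := 5) 2 K].
Proof.
have [K dimK] := exists_cubic_extension F.
(* Here k = 2: planes in dimension 2k + 1 = 5, and 2^3 = 8 of them. *)
exact: (exists_higgledy_piggledy dimK).
Qed.
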